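(* Let $\mathbb{C}$ be an initial configuration on $S$ stacks, and let $V_1,\dots,V_k$ be $k$ pairwise non-overlapping (disjoint) virtual layers, each of which satisfies P5. Then in every feasible move sequence for $\mathbb{C}$, at least $k$ non-BG moves are implemented on the blocks of $V_1\cup\dots\cup V_k$.
   Context: Setting (block relocation problem). There are $S$ stacks and $B$ blocks labelled by $\mathbb{B}=\{1,\dots,B\}$; a smaller label means a higher priority (earlier retrieval). A configuration places blocks in the stacks, each stack being a finite vertical sequence of blocks; the initial configuration $\mathbb{C}$ contains every block exactly once. A stack height limit $H$ may be imposed (each stack holds at most $H$ blocks; $H=\infty$ if there is no limit). A relocation takes the topmost block of a stack and puts it on top of a different stack (respecting the height limit). A retrieval removes from the bay the block of smallest label among those still present, and is allowed only if that block is topmost in its stack. A feasible move sequence is a finite sequence of relocations and retrievals starting from $\mathbb{C}$ after which all blocks have been retrieved. It is assumed that no block is directly retrievable in $\mathbb{C}$ (i.e. block $1$ is not topmost). In a given configuration, a block is badly placed (BP) if some block below it in the same stack has higher priority (smaller label); otherwise it is well placed (WP). A relocation is a BB, BG, GB or GG move, where the first letter is B (resp. G) if the moved block is BP (resp. WP) just before the move, and the second letter is B (resp. G) if it is BP (resp. WP) just after the move. A non-BG move is a BB, GB or GG move. The priority of a stack is the highest priority (smallest label) of a block in it, and $+\infty$ (the lowest priority) if it is empty. A virtual layer is a set of $S$ blocks, one from each stack of $\mathbb{C}$. A virtual layer $V$ satisfies P5 if (1) there exists a block lying in $\mathbb{C}$ below the block of $V$ in its stack, whose priority is higher than the highest priority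 of the blocks in $V$; and (2) the highest priority of the BP blocks (with respect to $\mathbb{C}$) in $V$ is lower than the lowest priority of all stacks after removing the blocks above $V$ (keeping in each stack only the block of $V$ and the blocks below it). *)

(* Defs.v *)
From HB Require Import structures.
From mathcomp Require Import all_boot.

Set Implicit Arguments.
Unset Strict Implicit.
Unset Printing Implicit Defensive.

(* The B blocks are the elements of 'I_B: the ordinal i stands for the block
   labelled i + 1, so the order on ordinals is the order on labels.
   A stack is listed from top to bottom: its head is the topmost block. *)
Definition config (S B : nat) := {ffun 'I_S -> seq 'I_B}.

(* The height limit H : option nat is None when there is no limit. *)
Definition within (H : option nat) (h : nat) : bool :=
  if H is Some m then h <= m else true.

Definition initial_config (S B : nat) (H : option nat) (C : config S B) : Prop :=
  (forall b : 'I_B, \sum_(s < S) count_mem b (C s) = 1) /\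
  (forall s : 'I_S, within H (size (C s))).

(* Relocate s t moves the top of stack s onto stack t; Retrieve s removes the
   top of stack s from the bay. *)
Inductive move (S : nat) : Type :=
| Relocate of 'I_S & 'I_S
| Retrieve of 'I_S.

Definition set_stack (S B : nat) (C : config S B) (s : 'I_S) (q : seq 'I_B) :
    config S B :=
  [ffun x => if x == s then q else C x].

Definition allowed (S B : nat) (H : option nat) (C : config S B) (m : move S) :
    bool :=
  match m with
  | Relocate s t =>
      [&& s != t, C s != [::] & within H (size (C t)).+1]
  | Retrieve s =>
      if C s is b :: _ then
        [forall t : 'I_S, all (fun c : 'I_B => b <= c) (C t)]
      else false
  end.

(* Only meaningful on allowed moves. *)
Definition exec (S B : nat) (C : config S B) (m : move S) : config S B :=
  match m with
  | Relocate s t =>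
      if C s is b :: q then set_stack (set_stack C s q) t (b :: C t) else C
  | Retrieve s => set_stack C s (behead (C s))
  end.

Fixpoint feasible (S B : nat) (H : option nat) (C : config S B)
    (ms : seq (move S)) : bool :=
  if ms is m :: ms' then allowed H C m && feasible H (exec C m) ms'
  else [forall s : 'I_S, C s == [::]].

Definition no_direct_retrieval (S B : nat) (H : option nat) (C : config S B) :
    Prop :=
  forall s : 'I_S, ~~ allowed H C (Retrieve s).

Definition lies_below (S B : nat) (C : config S B) (c b : 'I_B) : bool :=
  [exists s : 'I_S, (b \in C s) && (c \in drop (index b (C s)).+1 (C s))].

Definition badly_placed (S B : nat) (C : config S B) (b : 'I_B) : bool :=
  [exists c : 'I_B, lies_below C c b && (c < b)].

Definition moved_block (S B : nat) (C : config S B) (m : move S) : option 'I_B :=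
  if m is Relocate s _ then ohead (C s) else None.

Definition BB_move (S B : nat) (C : config S B) (m : move S) : bool :=
  if moved_block C m is Some b then
    badly_placed C b && badly_placed (exec C m) b else false.

Definition GB_move (S B : nat) (C : config S B) (m : move S) : bool :=
  if moved_block C m is Some b then
    ~~ badly_placed C b && badly_placed (exec C m) b else false.

Definition GG_move (S B : nat) (C : config S B) (m : move S) : bool :=
  if moved_block C m is Some b then
    ~~ badly_placed C b && ~~ badly_placed (exec C m) b else false.

Definition nonBG_move (S B : nat) (C : config S B) (m : move S) : bool :=
  [|| BB_move C m, GB_move C m | GG_move C m].

Definition moves_block_of (S B : nat) (A : {set 'I_B}) (C : config S B)
    (m : move S) : bool :=
  if moved_block C m is Some b then b \in A else false.

Fixpoint nonBG_count (S B : nat) (A : {set 'I_B}) (C : config S B)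
    (ms : seq (move S)) : nat :=
  if ms is m :: ms' then
    (moves_block_of A C m && nonBG_move C m) + nonBG_count A (exec C m) ms'
  else 0.

(* The smallest label in a collection of blocks. Ordinals of 'I_B are smaller
   than B, so the value B, taken on the empty collection, plays the role of
   +oo. *)
Definition highest_priority (B : nat) (P : pred 'I_B) : nat :=
  \big[minn/B]_(b : 'I_B | P b) b.

Definition stack_priority (B : nat) (q : seq 'I_B) : nat :=
  highest_priority (fun b => b \in q).

Definition virtual_layer (S B : nat) (C : config S B) (V : {set 'I_B}) : Prop :=
  #|V| = S /\ forall s : 'I_S, #|[set b in V | b \in C s]| = 1.

(* Stack s after removing the blocks above the block of V. *)
Definition remove_above (S B : nat) (C : config S B) (V : {set 'I_B}) (s : 'I_S) :
    seq 'I_B :=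
  drop (find (fun b => b \in V) (C s)) (C s).

(* A higher priority is a smaller label, so the lowest of the stack priorities
   is the maximum of their values. In P5_2 the set of badly placed blocks of V
   is nonempty as soon as P5_1 holds. *)
Definition P5_1 (S B : nat) (C : config S B) (V : {set 'I_B}) : Prop :=
  exists b c : 'I_B,
    [/\ b \in V, lies_below C c b & c < highest_priority (fun v => v \in V)].

Definition P5_2 (S B : nat) (C : config S B) (V : {set 'I_B}) : Prop :=
  \max_(s < S) stack_priority (remove_above C V s) <
    highest_priority (fun v => (v \in V) && badly_placed C v).

Definition P5 (S B : nat) (C : config S B) (V : {set 'I_B}) : Prop :=
  P5_1 C V /\ P5_2 C V.

(* Main.v *)
Require Import Defs.
From HB Require Import structures.
From mathcomp Require Import all_boot.

Set Implicit Arguments.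
Unset Strict Implicit.
Unset Printing Implicit Defensive.

(** Since the layers are disjoint, it suffices to find one non-BG move in each
    layer [V]. Until a block of [V] is touched, what lies on or below [V] stays
    in place. By P5 (1) a block outside [V] with priority over all of [V] is
    buried below [V], so the first block [v] of [V] to be touched is relocated,
    not retrieved. At that time [v] is badly placed only if it was so in the
    initial configuration; in that case P5 (2) says that every stack contains a
    block with priority over [v], so [v] is badly placed again. *)

Lemma highest_priority_le (B : nat) (P : pred 'I_B) (b : 'I_B) :
  P b -> highest_priority P <= b.
Proof.
move=> Pb; rewrite /highest_priority.
have: b \in index_enum 'I_B by rewrite mem_index_enum.
elim: (index_enum _) => [//|a r IHr]; rewrite inE big_cons.
case/predU1P => [<-|/IHr le_b]; first by rewrite Pb geq_minl.
by case: ifP => // _; apply: leq_trans (geq_minr _ _) le_b.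
Qed.

(** The bound [n <= B] excludes the default value [B] of an empty minimum, so a value below [n]
    comes from an actual block. *)
Lemma highest_priority_lt (B : nat) (P : pred 'I_B) (n : nat) :
  n <= B -> highest_priority P < n -> exists2 b : 'I_B, P b & b < n.
Proof.
move=> le_nB; rewrite /highest_priority.
apply: (big_rec (fun m => m < n -> exists2 b : 'I_B, P b & b < n)).
  by rewrite ltnNge le_nB.
by move=> b m Pb IHm; rewrite gtn_min => /orP[lt_bn|/IHm //]; exists b.
Qed.

Section RemoveAbove.

Variables (S B : nat) (V : {set 'I_B}).
Implicit Types (C D : config S B) (s t : 'I_S) (b v : 'I_B).

Lemma remove_above_cons C s b q : C s = b :: q ->
  remove_above C V s = if b \in V then b :: q else drop (find (mem V) q) q.
Proof. by rewrite /remove_above => -> /=; case: ifP. Qed.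

Lemma mem_remove_above C s b : b \in remove_above C V s -> b \in C s.
Proof. exact: mem_drop. Qed.

Lemma layer_mem_remove_above C s v :
  v \in V -> v \in C s -> v \in remove_above C V s.
Proof.
rewrite /remove_above => vV; elim: (C s) => //= b q IHq.
rewrite inE; case/predU1P => [<-|vq]; first by rewrite vV mem_head.
by case: ifP => _; [rewrite inE vq orbT | exact: IHq].
Qed.

(** The cut is made at the topmost block of [V], which is [v] or a block above it. *)
Lemma mem_drop_index_remove_above C s v :
  v \in V -> {subset drop (index v (C s)).+1 (C s) <= remove_above C V s}.
Proof.
rewrite /remove_above => vV c; elim: (C s) => //= b q IHq.
case: (b =P v) => [->|_].
  by rewrite vV /= drop0 inE => ->; rewrite orbT.
case: ifP => [_ /mem_drop cq|_ /IHq //]; by rewrite inE cq orbT.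
Qed.

Lemma remove_above_lies_below C s v q c :
  v \in V -> remove_above C V s = v :: q -> c \in q -> lies_below C c v.
Proof.
move=> vV Tv cq; apply/existsP; exists s.
have -> : v \in C s by apply: mem_remove_above; rewrite Tv mem_head.
move: Tv; rewrite /remove_above /=; elim: (C s) => //= b r IHr.
case: (boolP (b \in V)) => [_ [-> ->]|bNV /IHr]; first by rewrite eqxx drop0.
by case: (b =P v) => [bv|//]; rewrite bv vV in bNV.
Qed.

(** The cut drops exactly the blocks outside [V] that precede the first block of [V], so adding or
    removing one more such block on top does not affect what is kept. *)
Lemma remove_above_exec H C m s0 :
  allowed H C m ->
  (forall s b q, (m = Retrieve s \/ exists t, m = Relocate s t) ->
     C s = b :: q -> b \notin V) ->
  remove_above (exec C m) V s0 = remove_above C V s0.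
Proof.
case: m => [s t|s] /= al untouched.
  case/and3P: al => st; case Cs: (C s) => [//|b q] _ _.
  have bNV := untouched s b q (or_intror (ex_intro _ t erefl)) Cs.
  rewrite /remove_above !ffunE; case: (s0 =P t) => [->|_] /=.
    by rewrite (negPf bNV).
  by case: (s0 =P s) => [->|//]; rewrite Cs /= (negPf bNV).
case Cs: (C s) al => [//|b q] _.
have bNV := untouched s b q (or_introl erefl) Cs.
rewrite /remove_above !ffunE; case: (s0 =P s) => [->|//].
by rewrite Cs /= (negPf bNV).
Qed.

End RemoveAbove.

Lemma initial_config_stack_inj (S B : nat) (H : option nat) (C : config S B)
    (b : 'I_B) (s t : 'I_S) :
  initial_config H C -> b \in C s -> b \in C t -> s = t.
Proof.
case=> /(_ b) one _; rewrite -!has_pred1 !has_count => bs bt.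
apply/eqP/negPn/negP => st; move: one.
rewrite (bigD1 s) //= (bigD1 t) 1?eq_sym //=.
by case: (count _ _) bs => // m _; case: (count _ _) bt => // n _; rewrite addnS.
Qed.

Lemma stack_priority_lt (S B : nat) (C : config S B) (V : {set 'I_B})
    (v : 'I_B) (t : 'I_S) :
  P5_2 C V -> v \in V -> badly_placed C v ->
  exists2 c : 'I_B, c \in remove_above C V t & c < v.
Proof.
(* As an ordinal, [v] is below [B], so a stack priority smaller than [v] cannot be that of an empty
   stack. *)
move=> P52 vV bpv; apply: highest_priority_lt; first exact: ltnW.
have le_t := leq_bigmax (F := fun s => stack_priority (remove_above C V s)) t.
apply: (leq_ltn_trans le_t).
by apply: (leq_trans P52); apply: highest_priority_le; rewrite vV.
Qed.

Lemma badly_placed_top (S B : nat) (C : config S B) (b c : 'I_B) (s : 'I_S)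
    (q : seq 'I_B) :
  C s = b :: q -> c \in q -> c < b -> badly_placed C b.
Proof.
move=> Cs cq cb; apply/existsP; exists c; rewrite cb andbT.
by apply/existsP; exists s; rewrite Cs /= eqxx mem_head drop0.
Qed.

Lemma nonBG_moveE (S B : nat) (C : config S B) (m : move S) (b : 'I_B) :
  moved_block C m = Some b ->
  nonBG_move C m = ~~ badly_placed C b || badly_placed (exec C m) b.
Proof.
rewrite /nonBG_move /BB_move /GB_move /GG_move => ->.
by case: (badly_placed C b); case: (badly_placed (exec C m) b).
Qed.

Section OneLayer.

Variables (S B : nat) (H : option nat) (C : config S B) (V : {set 'I_B}).
Hypotheses (hC : initial_config H C) (hP5 : P5 C V).

(** Uniqueness of blocks is known for [C] only. Since [v] is in [V], each occurrence of [v] in [D]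
    shows up in the common part [remove_above], hence in [C]; so the stack witnessing bad placement
    is [s]. *)
Lemma badly_placed_initial (D : config S B) (s : 'I_S) (v : 'I_B) (q : seq 'I_B) :
  remove_above D V =1 remove_above C V -> D s = v :: q -> v \in V ->
  badly_placed D v -> badly_placed C v.
Proof.
move=> DC Ds vV /existsP[c /andP[/existsP[s' /andP[vs' cs']] lt_cv]].
have Ts : remove_above C V s = v :: q.
  by rewrite -DC (remove_above_cons V Ds) vV.
have s's : s' = s.
  apply: (initial_config_stack_inj (b := v) hC); apply: (@mem_remove_above _ _ V).
    by rewrite -DC; apply: layer_mem_remove_above.
  by rewrite Ts mem_head.
subst s'; move: cs'; rewrite Ds /= eqxx drop0 => cq.
by apply/existsP; exists c; rewrite lt_cv (remove_above_lies_below vV Ts cq).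
Qed.

Lemma nonBG_layer_move (D : config S B) (s t : 'I_S) (v : 'I_B) (q : seq 'I_B) :
  remove_above D V =1 remove_above C V -> s != t -> D s = v :: q -> v \in V ->
  nonBG_move D (Relocate s t).
Proof.
move=> DC st Ds vV.
rewrite (nonBG_moveE (b := v)) /moved_block ?Ds //.
case: (boolP (badly_placed D v)) => //= bpD.
have bpC := badly_placed_initial DC Ds vV bpD.
(* The block [c] belongs to the unchanged part of the target stack [t], so [v] lands above it. *)
have [c cT lt_cv] := stack_priority_lt t hP5.2 vV bpC.
apply: (@badly_placed_top _ _ _ _ c t (D t)) => //.
  by rewrite /= Ds !ffunE eqxx.
by apply: (@mem_remove_above _ _ V); rewrite DC.
Qed.

Lemma nonBG_count_layer (D : config S B) (ms : seq (move S)) :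
  remove_above D V =1 remove_above C V -> feasible H D ms ->
  0 < nonBG_count V D ms.
Proof.
have [b [c [bV /existsP[r /andP[_ cr]] c_prio]]] := hP5.1.
(* The block [c] of P5 (1) is in the part preserved by the invariant of the induction, so it stays
   in stack [r] as long as [V] is untouched. *)
have {cr} cT := mem_drop_index_remove_above bV cr.
elim: ms D => [|m ms IHms] D DC /=.
  move=> /forallP/(_ r)/eqP Dr.
  by move: cT; rewrite -DC /remove_above Dr.
case/andP=> al feas; rewrite addn_gt0.
have cD : c \in D r by apply: (@mem_remove_above _ _ V); rewrite DC.
(* A move of a block outside [V] preserves the invariant, which leaves the non-BG move to the
   remaining sequence. *)
have next : (forall s v q, (m = Retrieve s \/ exists t, m = Relocate s t) ->
    D s = v :: q -> v \notin V) -> 0 < nonBG_count V (exec D m) ms.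
  by move=> un; apply: IHms => // s; rewrite (remove_above_exec s al un).
case: m al next {IHms feas} => [s t|s] /= al next.
  case/and3P: al => st; case Ds: (D s) => [//|v q] _ _.
  case: (boolP (v \in V)) => [vV|vNV].
    by rewrite (nonBG_layer_move DC st Ds vV) /moves_block_of /moved_block Ds /= vV.
  apply/orP; right; rewrite Ds in next; apply: next => s' v' q' [//|[t' [<- _]]].
  by rewrite Ds => -[<- _].
(* A retrieved block has label at most that of [c], still present, whereas all labels in [V] exceed
   it. *)
case Ds: (D s) al => [//|v q] /forallP/(_ r)/allP/(_ c cD) le_vc.
rewrite Ds in next; apply: next => s' v' q' [[<-]|[t' //]].
rewrite Ds => -[<- _]; apply/negP => vV.
have := leq_trans c_prio (highest_priority_le (P := fun u => u \in V) vV).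
by rewrite ltnNge le_vc.
Qed.

End OneLayer.

(** The block moved at each step lies in at most one [V i], so no move is counted twice on the
    left. *)
Lemma sum_nonBG_count_disjoint (S B k : nat) (V : 'I_k -> {set 'I_B})
    (C : config S B) (ms : seq (move S)) :
  (forall i j : 'I_k, i != j -> [disjoint V i & V j]) ->
  \sum_(i < k) nonBG_count (V i) C ms <= nonBG_count (\bigcup_(i < k) V i) C ms.
Proof.
move=> disj; elim: ms C => [|m ms IHms] C /=; first by rewrite big1.
rewrite big_split /=; apply: leq_add (IHms _).
rewrite /moves_block_of; case: (moved_block C m) => [b|]; last by rewrite big1.
case: (nonBG_move C m); last by rewrite big1 // => i _; rewrite andbF.
case: (pickP (fun i => b \in V i)) => [i bi|none]; last first.
  by rewrite big1 // => i _; rewrite none.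
rewrite (bigD1 i) //= big1 => [|j ji].
  by rewrite bi (_ : b \in _) //; apply/bigcupP; exists i.
by rewrite (disjointFl (disj j i ji)).
Qed.

Theorem corollary1 (S B : nat) (H : option nat) (C : config S B)
    (hC : initial_config H C) (hret : no_direct_retrieval H C)
    (k : nat) (V : 'I_k -> {set 'I_B})
    (hV : forall i : 'I_k, virtual_layer C (V i))
    (hdisj : forall i j : 'I_k, i != j -> [disjoint V i & V j])
    (hP5 : forall i : 'I_k, P5 C (V i))
    (ms : seq (move S)) (hms : feasible H C ms) :
  k <= nonBG_count (\bigcup_(i < k) V i) C ms.
Proof.
apply: leq_trans (sum_nonBG_count_disjoint C ms hdisj).
rewrite -[X in X <= _]card_ord -sum1_card; apply: leq_sum => i _.
by apply: (nonBG_count_layer hC (hP5 i)).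
Qed.
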